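(* Let $\mathbb{V}$ and $\mathbb{V}'$ be finite-dimensional real vector spaces, $\mathbb{V}'$ equipped with an inner product $\langle\cdot,\cdot\rangle$, let $\mathcal{K}\subset\mathbb{V}'$ be a proper convex cone, and let $\mathcal{K}_*\subset\mathbb{V}'$ be its dual cone. Let $f:\operatorname{dom} f\rightarrow\mathbb{V}'$ be a $C^3$ function with open convex domain $\operatorname{dom} f\subset\mathbb{V}$. Suppose that for all $z\in\mathcal{K}_*$, $x\in\operatorname{dom} f$ and $h\in\mathbb{V}$ such that $x+h$ and $x-h$ both lie in $\operatorname{cl}\operatorname{dom} f$, the function $$F:(-1,1)\rightarrow\mathbb{R},\qquad F(t)=\langle z,f(x+th)\rangle,$$ is operator concave on $(-1,1)$. Then $f$ is $(\mathcal{K},1)$-compatible with respect to $\operatorname{cl}\operatorname{dom} f$.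
   Context: A proper convex cone is a closed convex cone that is pointed and has nonempty interior; $\mathcal{K}_*=\{z:\langle z,y\rangle\ge0\ \forall y\in\mathcal{K}\}$; $x\preceq_{\mathcal{K}}y$ means $y-x\in\mathcal{K}$; $\operatorname{cl}$ denotes closure. Operator concavity: for a real function $g$ on an interval $(a,b)$ and a Hermitian matrix $X=\sum_i\lambda_iv_iv_i^*$ (spectral decomposition) with all eigenvalues in $(a,b)$, put $g(X)=\sum_ig(\lambda_i)v_iv_i^*$. The function $g$ is operator concave on $(a,b)$ if for every positive integer $n$ and all $n\times n$ complex Hermitian matrices $X,Y$ with eigenvalues in $(a,b)$, $\lambda g(X)+(1-\lambda)g(Y)\preceq g(\lambda X+(1-\lambda)Y)$ (Loewner order) for all $\lambda\in[0,1]$. $f$ is $\mathcal{K}$-concave if $\lambda f(x)+(1-\lambda)f(y)\preceq_{\mathcal{K}}f(\lambda x+(1-\lambda)y)$ for all $x,y\in\operatorname{dom}f$, $\lambda\in[0,1]$. Compatibility: for $\beta\ge0$, a $C^3$ function $f$ with open domain is $(\mathcal{K},\beta)$-compatible with the domain $\operatorname{cl}\operatorname{dom}f$ if $f$ is $\mathcal{K}$-concave and $\mathsf{D}^3f(x)[h,h,h]\preceq_{\mathcal{K}}-3\beta\,\mathsf{D}^2f(x)[h,h]$ for all $x\in\operatorname{dom}f$ and $h\in\mathbb{V}$ such that $x\pm h\in\operatorname{cl}\operatorname{dom}f$, where $\mathsf{D}^kf(x)[h,\dots,h]$ is the $k$-th directional derivative at $x$ along $h$. *)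

(* Defs.v *)
From HB Require Import structures.
From mathcomp Require Import all_boot all_order all_algebra.
From mathcomp Require Import complex.
From mathcomp Require Import all_classical all_reals all_analysis.

Set Implicit Arguments.
Unset Strict Implicit.
Unset Printing Implicit Defensive.

Import Order.TTheory GRing.Theory Num.Theory.
Import numFieldNormedType.Exports.

Local Open Scope classical_set_scope.
Local Open Scope ring_scope.
Local Open Scope complex_scope.
Local Open Scope sesquilinear_scope.

(* Finite-dimensional normed spaces. In finite dimension all norms are
   equivalent, so the norm only serves to provide the canonical topology. *)
#[short(type="normedVectType")]
HB.structure Definition NormedVector (K : numDomainType) :=
  {V of NormedModule K V & Vector K V}.

Section Smoothness.
Context {R : realType} {V W : normedModType R}.

(* For V finite-dimensional, f is C^k.+1 on the open set D iff it is
   differentiable on D with derivative D -> Hom(V, W) of class C^k, i.e., iff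
   each evaluation x |-> 'd f x v = 'D_v f x of the derivative is C^k on D. *)
Fixpoint Cclass (k : nat) (D : set V) (f : V -> W) : Prop :=
  if k is k'.+1 then
    (forall x, D x -> differentiable f x) /\ (forall v, Cclass k' D ('D_v f))
  else forall x, D x -> {for x, continuous f}.

Definition dirderiv (k : nat) (f : V -> W) (h x : V) : W :=
  iter k (fun g => 'D_h g) f x.

End Smoothness.

Section Cones.
Context {R : realType} {W : normedModType R}.
Implicit Type K : set W.

Definition proper_convex_cone K :=
  [/\ closed K,
      convex_set (K : set (convex_lmodType W)) /\
        (forall (t : R) y, 0 <= t -> K y -> K (t *: y)),
      (forall y, K y -> K (- y) -> y = 0)
    & K^° !=set0].

Definition dual_cone (ip : {dot W for idfun}) K : set W :=
  [set z | forall y, K y -> 0 <= ip z y].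

Definition cone_le K (x y : W) := K (y - x).

End Cones.

Section Compatibility.
Context {R : realType} {V W : normedModType R}.
Variable K : set W.

(* A partial function with domain D is represented by a total function
   together with D; its values outside of D are irrelevant below. *)
Definition cone_concave (D : set V) (f : V -> W) :=
  forall x y (l : R), D x -> D y -> 0 <= l <= 1 ->
    cone_le K (l *: f x + (1 - l) *: f y) (f (l *: x + (1 - l) *: y)).

Definition compatible (beta : R) (D : set V) (f : V -> W) :=
  cone_concave D f /\
  forall x h, D x -> closure D (x + h) -> closure D (x - h) ->
    cone_le K (dirderiv 3 f h x) (- (3 * beta) *: dirderiv 2 f h x).

End Compatibility.

Section OperatorConcavity.
Context {R : realType}.
Implicit Type g : R -> R.

(* For X Hermitian, X = P^-1 diag(lambda) P with P := spectralmx X unitary and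
   lambda := spectral_diag X real, i.e. X = \sum_i lambda_i v_i v_i^* where
   v_i is the conjugate transpose of the i-th row of P; the result is then
   \sum_i g(lambda_i) v_i v_i^*. *)
Definition hermitian_fun g n (X : 'M[R[i]]_n) : 'M[R[i]]_n :=
  invmx (spectralmx X)
    *m diag_mx (map_mx (fun l => (g (complex.Re l))%:C) (spectral_diag X))
    *m spectralmx X.

Definition loewner_le n (X Y : 'M[R[i]]_n) :=
  (Y - X) \is hermsymmx /\
  forall v : 'cV[R[i]]_n, 0 <= (v ^t* *m (Y - X) *m v) 0 0.

(* The order on R[i] is partial: a%:C < l < b%:C entails that l is real. *)
Definition spectrum_in (a b : R) n (X : 'M[R[i]]_n) :=
  forall l, eigenvalue X l -> a%:C < l < b%:C.

Definition operator_concave (a b : R) g :=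
  forall n, (0 < n)%N -> forall X Y : 'M[R[i]]_n,
    X \is hermsymmx -> Y \is hermsymmx ->
    spectrum_in a b X -> spectrum_in a b Y ->
    forall l : R, 0 <= l <= 1 ->
      loewner_le
        (l%:C *: hermitian_fun g X + (1 - l)%:C *: hermitian_fun g Y)
        (hermitian_fun g (l%:C *: X + (1 - l)%:C *: Y)).

End OperatorConcavity.

(* Main.v *)
Require Import Defs.
From mathcomp Require Import all_boot all_order all_algebra.
From mathcomp Require Import complex ring lra.
From mathcomp Require Import all_classical all_reals all_analysis.
Import Order.TTheory GRing.Theory Num.Theory.
Import numFieldNormedType.Exports.
Local Open Scope classical_set_scope.
Local Open Scope ring_scope.
Set Implicit Arguments.
Unset Strict Implicit.
Unset Printing Implicit Defensive.

(* For z in the dual cone, u(t) = <z, f(x - t h)> is operator concave on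
   (-1, 1). Operator concavity on 2 x 2 matrices close to diag(0, t) yields in
   the limit Kraus' inequality: the matrix of second divided differences
   [[u[0,0,0], u[0,0,t]], [u[0,0,t], u[0,t,t]]] is negative semidefinite.
   Tested on (1, t/T - 1), which is the null vector of that matrix for the
   extremal function t^2 / (1 - t/T), it says that
   (1/t - 1/T)^2 (u(t) - u(0) - u'(0) t) / t - u''(0) / (2 t) is nonincreasing
   on (0, T]. Comparing its value -u''(0) / (2 T) at T with its limit
   u'''(0) / 6 - u''(0) / T at 0 gives u'''(0) >= 3 u''(0) / T, and T -> 1
   gives the bound. Since K is its own bidual, the inequalities for all z give
   the inequality in the cone order. *)

(** * Operator concavity on real symmetric matrices *)

Section HermitianFunctionalCalculus.
Context {R : realType}.
Local Open Scope complex_scope.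
Local Open Scope sesquilinear_scope.
Implicit Type g : R -> R.

(** The functional calculus does not depend on the diagonalisation: [M = P V] intertwines the two
    diagonal forms of [X], hence also their images under [g]. Since [V] is merely invertible,
    eigenvectors may stay unnormalised. *)
Lemma hermitian_funE g n (V U X : 'M[R[i]]_n) (d : 'rV[R]_n) :
  X \is hermsymmx -> V *m U = 1%:M ->
  X = V *m diag_mx (map_mx (real_complex R) d) *m U ->
  hermitian_fun g X = V *m diag_mx (map_mx (real_complex R \o g) d) *m U.
Proof.
move=> /hermitian_normalmx /orthomx_spectralP eX VU1 XE.
have UV1 : U *m V = 1%:M by exact: mulmx1C.
move: (spectral_unit X) eX; rewrite /hermitian_fun.
move: (spectralmx X) (spectral_diag X) => P e Punit eX.
have PQ1 := mulmxV Punit; have QP1 := mulVmx Punit.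
move: (invmx P) eX PQ1 QP1 => Q eX PQ1 QP1.
have [M eM] : exists M, M = P *m V by exists (P *m V).
have eqM : diag_mx e *m M = M *m diag_mx (map_mx (real_complex R) d).
  have := congr1 (fun Z => P *m Z *m V) (etrans (esym eX) XE).
  rewrite eM !mulmxA PQ1 mul1mx => ->.
  by rewrite -!mulmxA UV1 mulmx1.
(* Entrywise, [eqM] says that [e_i = d_j] wherever [M i j] is nonzero, so [g] may be applied to both
   sides. *)
have eqgM : diag_mx (map_mx (fun l => (g (complex.Re l))%:C) e) *m M =
            M *m diag_mx (map_mx (real_complex R \o g) d).
  apply/matrixP => i j; move/matrixP/(_ i j): eqM.
  rewrite !mul_diag_mx !mul_mx_diag !mxE /= [RHS]mulrC => eij.
  have [M0|Mn0] := eqVneq (M i j) 0; first by rewrite M0 mulr0 mul0r.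
  by rewrite (mulIf Mn0 eij) mulrC.
rewrite -[LHS]mulmx1 -VU1 -!mulmxA [P *m _]mulmxA -eM.
by rewrite [diag_mx _ *m _]mulmxA eqgM eM !mulmxA QP1 mul1mx.
Qed.

(** A left eigenvector [v] of [X] becomes a left eigenvector [v V] of the diagonal matrix; any
    nonzero coordinate of it identifies the eigenvalue with a diagonal entry. *)
Lemma spectrum_in_diag a b n (V U X : 'M[R[i]]_n) (d : 'rV[R]_n) :
  V *m U = 1%:M -> X = V *m diag_mx (map_mx (real_complex R) d) *m U ->
  (forall i, a < d 0 i < b) -> spectrum_in a b X.
Proof.
move=> VU1 XE dab l /eigenvalueP[v vX vn0].
have UV1 : U *m V = 1%:M by exact: mulmx1C.
have [w ew] : exists w, w = v *m V by exists (v *m V).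
have /rV0Pn[j wj] : w != 0.
  apply: contraNneq vn0 => w0.
  by rewrite -(mulmx1 v) -VU1 mulmxA -ew w0 mul0mx.
have /matrixP/(_ 0 j) : w *m diag_mx (map_mx (real_complex R) d) = l *: w.
  by rewrite ew scalemxAl -vX XE -!mulmxA UV1 mulmx1.
rewrite mul_mx_diag !mxE mulrC => /(mulIf wj) <-.
by rewrite !ltcR.
Qed.

Lemma map_real_hermsymmx n (A : 'M[R]_n) : A^T = A ->
  map_mx (real_complex R) A \is hermsymmx.
Proof.
move=> symA; apply/is_hermitianmxP; rewrite expr0 scale1r -[in LHS]symA.
by apply/matrixP => i j; rewrite !mxE; exact/esym/conjc_real.
Qed.

Lemma real_loewner_leP n (A B : 'M[R]_n) :
  loewner_le (map_mx (real_complex R) A) (map_mx (real_complex R) B) ->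
  forall v : 'cV[R]_n, (v^T *m A *m v) 0 0 <= (v^T *m B *m v) 0 0.
Proof.
case=> _ + v => /(_ (map_mx (real_complex R) v)).
have -> : (map_mx (real_complex R) v)^t* = map_mx (real_complex R) v^T.
  by apply/matrixP => i j; rewrite !mxE; exact: conjc_real.
rewrite -map_mxB -!map_mxM mxE lecR mulmxBr mulmxBl.
by rewrite !mxE subr_ge0.
Qed.

Lemma hermitian_fun_real g n (V U X : 'M[R]_n) (d : 'rV[R]_n) :
  X^T = X -> V *m U = 1%:M -> X = V *m diag_mx d *m U ->
  hermitian_fun g (map_mx (real_complex R) X) =
  map_mx (real_complex R) (V *m diag_mx (map_mx g d) *m U).
Proof.
move=> symX VU1 XE.
rewrite (@hermitian_funE g _ (map_mx (real_complex R) V)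
  (map_mx (real_complex R) U) _ d); first last.
- by rewrite -map_diag_mx -!map_mxM -XE.
- by rewrite -map_mxM VU1 map_mx1.
- exact: map_real_hermsymmx.
by rewrite map_mx_comp -map_diag_mx -!map_mxM.
Qed.

Lemma spectrum_in_real a b n (V U X : 'M[R]_n) (d : 'rV[R]_n) :
  V *m U = 1%:M -> X = V *m diag_mx d *m U ->
  (forall i, a < d 0 i < b) -> spectrum_in a b (map_mx (real_complex R) X).
Proof.
move=> VU1 XE; apply: (@spectrum_in_diag _ _ _ (map_mx (real_complex R) V)
  (map_mx (real_complex R) U)).
- by rewrite -map_mxM VU1 map_mx1.
- by rewrite -map_diag_mx -!map_mxM -XE.
Qed.

(** Operator concavity with explicit real diagonalisations of [A] and [B]. The average is asked to
    be diagonal already, so that [g] acts on it entry by entry. *)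
Lemma operator_concave_real a b g n (A B : 'M[R]_n) (U V U' V' : 'M[R]_n)
    (d d' e : 'rV[R]_n) (l : R) :
  (0 < n)%N -> operator_concave a b g -> 0 <= l <= 1 ->
  A^T = A -> B^T = B ->
  V *m U = 1%:M -> V' *m U' = 1%:M ->
  A = V *m diag_mx d *m U -> B = V' *m diag_mx d' *m U' ->
  l *: A + (1 - l) *: B = diag_mx e ->
  (forall i, a < d 0 i < b) -> (forall i, a < d' 0 i < b) ->
  forall v : 'cV[R]_n,
  (v^T *m (l *: (V *m diag_mx (map_mx g d) *m U) +
          (1 - l) *: (V' *m diag_mx (map_mx g d') *m U')) *m v) 0 0 <=
  (v^T *m diag_mx (map_mx g e) *m v) 0 0.
Proof.
move=> n0 gconc l01 symA symB VU VU' eA eB eC dab dab' v.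
have := gconc _ n0 _ _ (map_real_hermsymmx symA) (map_real_hermsymmx symB)
  (spectrum_in_real VU eA dab) (spectrum_in_real VU' eB dab') _ l01.
rewrite (hermitian_fun_real g symA VU eA) (hermitian_fun_real g symB VU' eB).
rewrite -!map_mxZ -!map_mxD eC.
rewrite (@hermitian_fun_real g _ 1%:M 1%:M _ e) ?tr_diag_mx ?mulmx1 ?mul1mx //.
by move/real_loewner_leP/(_ v).
Qed.

(* The two matrices are [x v v^T + t w w^T] and [y v' v'^T + t w' w'^T] with
   v = (1, e), w = (-e, 1), v' = (1, -e), w' = (e, 1) (up to normalisation);
   [offdiag] makes their average diagonal. *)
Lemma operator_concave_jensen2 a b g (l x y t e k : R) (m := l * x + (1 - l) * y) :
  operator_concave a b g -> 0 <= l <= 1 ->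
  a < x < b -> a < y < b -> a < t < b ->
  forall offdiag : e * (l * (t - x) - (1 - l) * (t - y)) = 0,
  l * ((k + e) ^+ 2 * g x + (1 - k * e) ^+ 2 * g t) +
  (1 - l) * ((k - e) ^+ 2 * g y + (1 + k * e) ^+ 2 * g t) <=
  (1 + e ^+ 2) * (k ^+ 2 * g ((m + e ^+ 2 * t) / (1 + e ^+ 2))
                  + g ((t + e ^+ 2 * m) / (1 + e ^+ 2))).
Proof.
move=> gconc l01 xab yab tab offdiag.
have D0 : 1 + e ^+ 2 != 0 by rewrite gt_eqF // ltr_wpDr // sqr_ge0.
pose mk (p q r s : R) : 'M[R]_2 :=
  \matrix_(i, j) if i == 0 then (if j == 0 then p else q)
                 else (if j == 0 then r else s).
pose rv (p q : R) : 'rV[R]_2 := \row_j if j == 0 then p else q.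
have mkT p q r s : (mk p q r s)^T = mk p r q s.
  by apply/matrixP => i j; rewrite !mxE; case: eqP; case: eqP.
have mkM p q r s p' q' r' s' : mk p q r s *m mk p' q' r' s' =
    mk (p * p' + q * r') (p * q' + q * s') (r * p' + s * r') (r * q' + s * s').
  apply/matrixP => i j; rewrite !mxE !big_ord_recl big_ord0 !mxE /= addr0.
  by case: eqP; case: eqP.
have mkD p q r s p' q' r' s' : mk p q r s + mk p' q' r' s' =
    mk (p + p') (q + q') (r + r') (s + s').
  by apply/matrixP => i j; rewrite !mxE; case: eqP; case: eqP.
have mkZ c p q r s : c *: mk p q r s = mk (c * p) (c * q) (c * r) (c * s).
  by apply/matrixP => i j; rewrite !mxE; case: eqP; case: eqP.
have mkdiag p q : diag_mx (rv p q) = mk p 0 0 q.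
  apply/matrixP => i j; rewrite !mxE.
  by case: i => [[|[|//]] ?]; case: j => [[|[|//]] ?]; rewrite /= ?mulr1n ?mulr0n.
have mk1 : 1%:M = mk 1 0 0 1.
  apply/matrixP => i j; rewrite !mxE.
  by case: i => [[|[|//]] ?]; case: j => [[|[|//]] ?].
have rvmap h p q : map_mx h (rv p q) = rv (h p) (h q).
  by apply/matrixP => i j; rewrite !mxE; case: eqP.
have rvP c d p q : c < p < d -> c < q < d -> forall i, c < rv p q 0 i < d.
  by move=> ? ? i; rewrite mxE; case: eqP.
(* The rows of [U f] are the orthogonal eigenvectors (1, f) and (-f, 1); [V f] is the inverse of
   [U f] as soon as [f ^+ 2 = e ^+ 2], so both tilts [e] and [- e] share one denominator. *)
pose U f := mk 1 f (- f) 1.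
pose V f := mk (1 / (1 + e ^+ 2)) (- f / (1 + e ^+ 2))
               (f / (1 + e ^+ 2)) (1 / (1 + e ^+ 2)).
have VU f : f ^+ 2 = e ^+ 2 -> V f *m U f = 1%:M.
  move=> fe; rewrite mkM mk1 -fe; congr mk; field; by rewrite fe.
have quad (v := \col_(i < 2) (if i == 0 then k else 1)) p q r s :
    (v^T *m mk p q r s *m v) 0 0 = k * k * p + k * q + k * r + s.
  rewrite !mxE !big_ord_recl !mxE !big_ord_recl /= !mxE /= !big_ord0; ring.
have := @operator_concave_real a b g 2 (V e *m diag_mx (rv x t) *m U e)
  (V (- e) *m diag_mx (rv y t) *m U (- e)) (U e) (V e) (U (- e)) (V (- e))
  (rv x t) (rv y t)
  (rv ((m + e ^+ 2 * t) / (1 + e ^+ 2)) ((t + e ^+ 2 * m) / (1 + e ^+ 2))) l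
  isT gconc l01.
have e2 : (- e) ^+ 2 = e ^+ 2 by rewrite sqrrN.
move=> /(_ _ _ (VU _ erefl) (VU _ e2) erefl erefl _ (rvP _ _ _ _ xab tab)
  (rvP _ _ _ _ yab tab) (\col_(i < 2) (if i == 0 then k else 1))).
rewrite !rvmap !mkdiag !mkM !mkT !mkZ !mkD !quad => jensen.
rewrite -(ler_pM2l (x := (1 + e ^+ 2)^-1)) ?invr_gt0 ?ltr_wpDr ?sqr_ge0 //.
rewrite mulKf //.
apply: le_trans (le_trans (jensen _ _ _) _); first 1 last.
- by congr mk; ring.
- by congr mk; ring.
(* Each off-diagonal entry of the average is this multiple of the left side of [offdiag]. *)
- have offdiag0 : 0 = - (1 + e ^+ 2)^-1 * (e * (l * (t - x) - (1 - l) * (t - y))).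
    by rewrite offdiag mulr0.
  by congr mk; rewrite 1?[RHS]offdiag0 /m; field.
- by rewrite le_eqVlt; apply/orP; left; apply/eqP; ring.
by rewrite le_eqVlt; apply/orP; left; apply/eqP; field.
Qed.
End HermitianFunctionalCalculus.

(** * Taylor expansions and the third derivative *)

Section Taylor.
Context {R : realType}.
Implicit Types f df : R -> R.

(** Mean value theorem from 0 for either sign of [s]. The bound [|c| <= |s|] is what squeezes [c] to
    0 along with [s]. *)
Lemma MVT0 f df (s : R) : s != 0 ->
  (forall x : R, `|x| <= `|s| -> is_derive x 1 f (df x)) ->
  exists2 c, `|c| <= `|s| & f s - f 0 = df c * s.
Proof.
move=> s0 dfs.
have cont (a b : R) : (forall x, x \in `[a, b] -> `|x| <= `|s|) ->
    {within `[a, b], continuous f}.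
  move=> ab; apply: derivable_within_continuous => x /ab /dfs.
  by move=> dx; exact: ex_derive.
have [sneg|spos|/esym/eqP] := ltgtP s 0; last by rewrite eq_sym (negbTE s0).
- have ns x : x \in `[s, 0] -> `|x| <= `|s|.
    rewrite in_itv /= => /andP[sx x0]; by rewrite (ltr0_norm sneg) (ler0_norm x0) lerN2.
  have [|c cs fE] := @MVT _ f df _ _ sneg _ (cont _ _ ns).
    by move=> x xs; apply/dfs/ns; exact: subset_itv_oo_cc.
  exists c; first exact/ns/subset_itv_oo_cc.
  by rewrite -[LHS]opprB fE; ring.
- have ns x : x \in `[0, s] -> `|x| <= `|s|.
    by rewrite in_itv /= => /andP[x0 xs]; rewrite (gtr0_norm spos) (ger0_norm x0).
  have [|c cs fE] := @MVT _ f df _ _ spos _ (cont _ _ ns).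
    by move=> x xs; apply/dfs/ns; exact: subset_itv_oo_cc.
  exists c; first exact/ns/subset_itv_oo_cc.
  by rewrite fE subr0.
Qed.

(** The form [a * s ^+ n.+1] is why first powers and unit coefficients are written out as [s ^+ 1]
    and [1 * t ^+ 3] below. *)
Lemma is_derive_monomial n (a x : R) :
  is_derive x 1 (fun s => a * s ^+ n.+1) (a * n.+1%:R * x ^+ n).
Proof.
have dX : is_derive x 1 (fun s : R => s ^+ n.+1) (n.+1%:R *: x ^+ n *: 1).
  by split; [exact: exprn_derivable|exact: exp_derive].
apply: (is_derive_eq (is_deriveZ a dX)).
by rewrite /GRing.scale /= mulr1 mulrA.
Qed.

(** Integrates a remainder of order [n] with a continuous factor. The mean value theorem is applied
    to [f] minus its leading monomial, whose derivative is [x ^+ n * (psi x - psi 0)]. *)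
Lemma Taylor_step n f (psi : R -> R) : f 0 = 0 -> {for 0, continuous psi} ->
  (\forall x \near (0 : R), is_derive (x : R) 1 f (x ^+ n * psi x)) ->
  exists w : R -> R, [/\ {for 0, continuous w}, w 0 = psi 0 / n.+1%:R &
    forall s, f s = s ^+ n.+1 * w s].
Proof.
move=> f0 psic dfn.
(* As a quotient, [w] satisfies the identity for every [s]; the derivative of [f] near 0 serves only
   for continuity at 0. *)
pose w s := if s == 0 then psi 0 / n.+1%:R else f s / s ^+ n.+1.
have w0 : w 0 = psi 0 / n.+1%:R by rewrite /w eqxx.
exists w; split => //; last first.
  move=> s; rewrite /w; have [->|s0] := eqVneq s 0; first by rewrite f0 expr0n mul0r.
  by rewrite mulrC divfK // expf_eq0 (negbTE s0) andbF.
apply/cvgrPdist_le => e e0.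
have [/= r r0 rP] : \forall x \near (0 : R),
    is_derive (x : R) 1 f (x ^+ n * psi x) /\ `|psi 0 - psi x| <= e.
  by near=> x; split; near: x => //; move/cvgrPdist_le : psic; apply.
suff : \forall s \near (0 : R), `|w 0 - w s| <= e by [].
near=> s; rewrite w0 /w; case: eqVneq => [_|s0]; first by rewrite subrr normr0 ltW.
pose phi (x : R) := f x - psi 0 / n.+1%:R * x ^+ n.+1.
have [|c cs] := @MVT0 phi (fun x => x ^+ n * (psi x - psi 0)) s s0.
  move=> x xs; have [|dx _] := rP x.
    rewrite /= sub0r normrN; apply: (le_lt_trans xs).
    by near: s; exact: (@nbhs0_lt R R^o).
  apply: (is_derive_eq (is_deriveB dx (is_derive_monomial n (psi 0 / n.+1%:R) x))).
  by field.
rewrite /phi f0 expr0n /= mulr0 subrr subr0 => phis.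
have -> : psi 0 / n.+1%:R - f s / s ^+ n.+1 =
    - (c / s) ^+ n * (psi c - psi 0).
  rewrite -[f s](subrK (psi 0 / n.+1%:R * s ^+ n.+1)) phis expr_div_n exprS.
  field.
  by rewrite expf_neq0 // s0 nat1r pnatr_eq0.
(* The first factor is at most 1 because [|c| <= |s|]; the second is small by continuity of [psi] at
   0. *)
rewrite normrM normrN -[e]mul1r ler_pM //.
  rewrite normrX exprn_ile1 // normrM normfV ler_pdivrMr ?normr_gt0 ?mul1r //.
rewrite distrC; apply: (rP _ _).2; rewrite /= sub0r normrN; apply: (le_lt_trans cs).
by near: s; exact: (@nbhs0_lt R R^o).
Unshelve. all: by end_near. Qed.

(** Differentiability of [f1] at 0 in Caratheodory's form is an expansion of [f1] with continuous
    factor [psi], which [Taylor_step] integrates. *)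
Lemma Taylor2 f f1 (a : R) :
  (\forall x \near (0 : R), is_derive (x : R) 1 f (f1 x)) -> is_derive (0 : R) 1 f1 a ->
  exists w : R -> R, [/\ {for 0, continuous w}, w 0 = a / 2 &
    forall s, f s = f 0 + f1 0 * s + s ^+ 2 * w s].
Proof.
move=> df /is_derive1_caratheodory[psi [f1E psic psi0]].
have [|||w [wc w0 wE]] := @Taylor_step 1 (fun s => f s - f 0 - f1 0 * s ^+ 1) psi.
- by rewrite subrr expr1 mulr0 subr0.
- exact: psic.
- near=> x.
  have dx : is_derive x 1 f (f1 x) by near: x.
  apply: (is_derive_eq (is_deriveB (is_deriveB dx (is_derive_cst (f 0) x 1))
     (is_derive_monomial 0 (f1 0) x))).
  by have := f1E x; rewrite subr0 expr0 expr1 !mulr1 subr0 [x * _]mulrC.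
exists w; split => //; first by rewrite w0 psi0.
by move=> s; rewrite -wE expr1; ring.
Unshelve. all: by end_near. Qed.

Lemma Taylor3 f f1 f2 (a : R) :
  (\forall x \near (0 : R), is_derive (x : R) 1 f (f1 x)) ->
  (\forall x \near (0 : R), is_derive (x : R) 1 f1 (f2 x)) -> is_derive (0 : R) 1 f2 a ->
  exists w : R -> R, [/\ {for 0, continuous w}, w 0 = a / 6 &
    forall s, f s = f 0 + f1 0 * s + f2 0 / 2 * s ^+ 2 + s ^+ 3 * w s].
Proof.
move=> df df1 df2; have [psi [psic psi0 f1E]] := Taylor2 df1 df2.
have [|||w [wc w0 wE]] := @Taylor_step 2
  (fun s => f s - f 0 - f1 0 * s ^+ 1 - f2 0 / 2 * s ^+ 2) psi.
- by rewrite subrr expr1 expr0n /= !mulr0 !subr0.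
- exact: psic.
- near=> x.
  have dx : is_derive x 1 f (f1 x) by near: x.
  apply: (is_derive_eq (is_deriveB (is_deriveB (is_deriveB dx (is_derive_cst (f 0) x 1))
     (is_derive_monomial 0 (f1 0) x)) (is_derive_monomial 1 (f2 0 / 2) x))).
  by rewrite f1E; field.
exists w; split => //; first by rewrite w0 psi0; field.
by move=> s; rewrite -wE expr1; ring.
Unshelve. all: by end_near. Qed.
End Taylor.

(** Proves a limit by descending through the arithmetic structure of the function. The first three
    cases restore the identity argument hidden in eta-reduced functions. *)
Ltac cvg_step :=
  lazymatch goal with
  | |- context [fmap ( *%R ?c) _] => apply: (@cvgM _ _ _ _ (fun=> c) id)
  | |- context [fmap ( +%R ?c) _] => apply: (@cvgD _ _ _ _ _ (fun=> c) id)
  | |- context [fmap -%R _] => apply: (@cvgN _ _ _ _ _ id)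
  | |- context [fmap (fun _ => ?c) _] => exact: cvg_cst
  | |- is_true (_ != _) => assumption
  | |- context [fmap (fun s => (@?f s) + (@?g s)) _] => apply: cvgD
  | |- context [fmap (fun s => - (@?f s)) _] => apply: cvgN
  | |- context [fmap (fun s => (@?f s) * (@?g s)) _] => apply: cvgM
  | |- context [fmap (fun s => (@?f s)^-1) _] => apply: cvgV
  | |- _ => assumption
  end.

(** * Kraus' inequality and the resulting bound on the third derivative *)

Section ThirdDerivative.
Context {R : realType}.
Implicit Types u w : R -> R.

(** The left side is [t ^+ 2] times the quadratic form of Kraus' matrix at (1, -k): with
    [G = u t - u 0 - b * t], the divided differences are [w 0], [G / t ^+ 2] and
    [(t * (a - b) - G) / t ^+ 2]. *)
Lemma operator_concave_kraus u w (a b t k : R) :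
  operator_concave (-1) 1 u -> {for 0, continuous w} ->
  (forall s, u s = u 0 + b * s + s ^+ 2 * w s) ->
  0 < t < 1 -> is_derive t 1 u a ->
  t ^+ 2 * w 0 - 2 * k * (u t - u 0 - b * t)
    + k ^+ 2 * (t * (a - b) - (u t - u 0 - b * t)) <= 0.
Proof.
move=> uconc wc uE /andP[t0 t1] /is_derive1_caratheodory[v [vE vc va]].
set G := u t - u 0 - b * t.
(* [operator_concave_jensen2] for the weight (1 + s) / 2, eigenvalues
   t s / (1 + s) and - t s / (1 - s), tilt [e s] and test vector (s, 1), divided
   by s^4; the choice makes the averaged matrix diag(0, t) up to order s^4. *)
pose e s := k * (s * s).
pose Phi s := (1 + s) / 2 * ((1 + k * s) * (1 + k * s)) * (t / (1 + s) * (t / (1 + s)))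
    * w (t * s / (1 + s))
  + (1 - s) / 2 * ((1 - k * s) * (1 - k * s)) * (t / (1 - s) * (t / (1 - s)))
    * w (- (t * s / (1 - s)))
  + (k * k * (s * s) - 2 * k - k * k) * G
  + t * (k * k) * (v (t / (1 + e s * e s)) - b)
  - s * s * (e s * e s) * (k * k) * (t * t) / (1 + e s * e s)
     * w (e s * e s * t / (1 + e s * e s)).
have -> : t ^+ 2 * w 0 - 2 * k * G + k ^+ 2 * (t * (a - b) - G) = Phi 0.
  rewrite /Phi /e !(mulr0, mul0r, addr0, subr0, oppr0, divr1) va; by field.
have Phic (F : set_system R) : ProperFilter F -> s @[s --> F] --> (0 : R) ->
    Phi s @[s --> F] --> Phi 0.
  move=> FF F0.
  have vc' : {for t / (1 + e 0 * e 0), continuous v}.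
    by rewrite /e !(mulr0, addr0) divr1.
  have wc1 : {for t * 0 / (1 + 0), continuous w} by rewrite mulr0 mul0r.
  have wc2 : {for - (t * 0 / (1 - 0)), continuous w} by rewrite mulr0 mul0r oppr0.
  have wc3 : {for e 0 * e 0 * t / (1 + e 0 * e 0), continuous w}.
    by rewrite /e !(mulr0, mul0r).
  have D1 : (1 + 0 : R) != 0 by rewrite addr0 oner_neq0.
  have D2 : (1 - 0 : R) != 0 by rewrite subr0 oner_neq0.
  have D3 : 1 + e 0 * e 0 != 0 by rewrite /e !mulr0 addr0 oner_neq0.
  have Fe : e s @[s --> F] --> e 0 by rewrite /e; repeat cvg_step.
  have Fw1 : w (t * s / (1 + s)) @[s --> F] --> w (t * 0 / (1 + 0)).
    by apply: (@continuous_cvg _ _ _ F _ (fun s => t * s / (1 + s)) w _ wc1);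
      repeat cvg_step.
  have Fw2 : w (- (t * s / (1 - s))) @[s --> F] --> w (- (t * 0 / (1 - 0))).
    by apply: (@continuous_cvg _ _ _ F _ (fun s => - (t * s / (1 - s))) w _ wc2);
      repeat cvg_step.
  have Fw3 : w (e s * e s * t / (1 + e s * e s)) @[s --> F] -->
      w (e 0 * e 0 * t / (1 + e 0 * e 0)).
    by apply: (@continuous_cvg _ _ _ F _ (fun s => e s * e s * t / (1 + e s * e s)) w _ wc3);
      repeat cvg_step.
  have Fv : v (t / (1 + e s * e s)) @[s --> F] --> v (t / (1 + e 0 * e 0)).
    by apply: (@continuous_cvg _ _ _ F _ (fun s => t / (1 + e s * e s)) v _ vc');
      repeat cvg_step.
  by rewrite /Phi; repeat cvg_step.
have Phir : Phi s @[s --> (0 : R)^'+] --> Phi 0.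
  by apply: Phic; apply: cvg_at_right_filter; exact: cvg_id.
apply: (cvgr_to_le Phir).
near=> s.
have s0 : 0 < s by near: s; exact: nbhs_right_gt.
(* Below 1/2 one has [s / (1 - s) < 1], which keeps the negative eigenvalue above -1. *)
have s2 : s < 1 / 2 by near: s; apply: nbhs_right_lt; rewrite divr_gt0.
have s1p : 1 + s != 0 by rewrite gt_eqF //; lra.
have s1m : 1 - s != 0 by rewrite gt_eqF //; lra.
have E0 : 1 + (e s) ^+ 2 != 0 by rewrite gt_eqF // ltr_wpDr // sqr_ge0.
have xlt : -1 < t * s / (1 + s) < 1.
  apply/andP; split; last by rewrite ltr_pdivrMr; nra.
  by rewrite (@lt_le_trans _ _ 0) // divr_ge0 ?mulr_ge0 //; lra.
have ylt : -1 < - (t * s / (1 - s)) < 1.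
  rewrite ltrN2; apply/andP; split; first by rewrite ltr_pdivrMr; nra.
  by rewrite ltrNl (@lt_le_trans _ _ 0) // divr_ge0 ?mulr_ge0 //; lra.
have tlt : -1 < t < 1 by rewrite t1 (lt_trans _ t0).
have l01 : 0 <= (1 + s) / 2 <= 1 by apply/andP; split; lra.
have := @operator_concave_jensen2 _ (-1) 1 u _ _ _ t (e s) s uconc l01 xlt ylt tlt.
(* The weighted small eigenvalues cancel, so [m = 0]; moreover [l * (t - x)] and [(1 - l) * (t - y)]
   both equal [t / 2], which gives [offdiag]. *)
have -> : (1 + s) / 2 * (t * s / (1 + s)) + (1 - (1 + s) / 2) * - (t * s / (1 - s)) = 0.
  by field; rewrite s1p s1m.
rewrite add0r mulr0 addr0 => /(_ _)/wrap[].
  by field; rewrite s1p s1m.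
(* The averaged eigenvalue near [t] is expanded to first order by [v]; the three eigenvalues near 0
   are expanded to second order by [w]. *)
have /eqP := vE (t / (1 + e s ^+ 2)); rewrite subr_eq => /eqP ->.
rewrite -subr_le0 => J.
rewrite -(pmulr_rle0 _ (exprn_gt0 4 s0)); apply: le_trans J.
rewrite le_eqVlt; apply/orP; left; apply/eqP.
rewrite (uE (t * s / (1 + s))) (uE (- (t * s / (1 - s)))) (uE (_ * t / _)).
have -> : u t = u 0 + b * t + G by rewrite /G; ring.
rewrite /Phi -!(expr2 (e s)).
move: (w _) (w _) (w _) (v _) => w1 w2 w3 v1.
rewrite /e in E0 *; field.
by rewrite E0 s1p s1m.
Unshelve. all: by end_near. Qed.

Lemma operator_concave_third_derivative u (u1 u2 : R -> R) (a : R) :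
  operator_concave (-1) 1 u ->
  (forall t : R, -1 < t < 1 -> is_derive t 1 u (u1 t)) ->
  (forall t : R, -1 < t < 1 -> is_derive t 1 u1 (u2 t)) ->
  is_derive (0 : R) 1 u2 a -> 3 * u2 0 <= a.
Proof.
move=> uconc du du1 du2.
have near1 : \forall t \near (0 : R), -1 < t < 1.
  near=> t; rewrite -ltr_norml; near: t; exact: (@nbhs0_lt R R^o).
have ndu : \forall t \near (0 : R), is_derive (t : R) 1 u (u1 t).
  by apply: filterS near1 => t /du.
have ndu1 : \forall t \near (0 : R), is_derive (t : R) 1 u1 (u2 t).
  by apply: filterS near1 => t /du1.
have [w [wc w0 wE]] := Taylor2 ndu (du1 0 (andb_true_intro (conj (ltrN10 _) ltr01))).
have [r [rc r0 rE]] := Taylor3 ndu ndu1 du2.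
pose b := u1 0; pose c := u2 0 / 2.
suff aT (T : R) : 0 < T < 1 -> 3 * u2 0 <= a * T.
  have : a * T @[T --> (1 : R)^'-] --> a * 1.
    by apply: cvg_at_left_filter; apply: cvgM; [exact: cvg_cst|exact: cvg_id].
  rewrite mulr1 => aTc; refine (@cvgr_to_ge _ _ _ R _ a _ aTc _).
  near=> T; apply: aT; apply/andP; split; first by near: T; exact: nbhs_left_gt.
  by near: T; exact: nbhs_left_lt.
move=> /andP[T0 T1].
pose G (t : R) : R := u t - u 0 - b * t ^+ 1.
(* This is [(1 - t / T) ^+ 2] expanded into monomials, so that [q] is the function of the overview,
   with value [- c / T] at [T]. *)
pose A (t : R) : R := 1 - 2 / T * t ^+ 1 + T^-1 ^+ 2 * t ^+ 2.
pose q (t : R) : R := A t * G t * (1 * t ^+ 3)^-1 - c * (1 * t ^+ 1)^-1.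
have dq (t : R) : 0 < t <= T -> exists2 q1 : R, q1 <= 0 & is_derive t 1 q q1.
  move=> /andP[t0 tT].
  have t1 : t < 1 by exact: le_lt_trans tT T1.
  have tlt : -1 < t < 1 by rewrite t1 (lt_trans _ t0).
  have tn0 : t != 0 by rewrite gt_eqF.
  have dut := du t tlt.
  have t3 : 1 * t ^+ 3 != 0 by rewrite mul1r expf_neq0.
  have t11 : 1 * t ^+ 1 != 0 by rewrite mul1r expf_neq0.
  have dG : is_derive t 1 G _ := is_deriveB (is_deriveB dut (is_derive_cst (u 0) t 1))
    (is_derive_monomial 0 b t).
  have dA : is_derive t 1 A _ := is_deriveD (is_deriveB (is_derive_cst (1 : R) t 1)
    (is_derive_monomial 0 (2 / T) t)) (is_derive_monomial 1 (T^-1 ^+ 2) t).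
  have dq := is_deriveB (is_deriveM (is_deriveM dA dG)
      (@is_deriveV _ (fun s : R => 1 * s ^+ 3) t _ 1 t3 (is_derive_monomial 2 1 t)))
    (is_deriveZ c (@is_deriveV _ (fun s : R => 1 * s ^+ 1) t _ 1 t11
      (is_derive_monomial 0 1 t))).
  eexists; last exact: dq.
  (* The derivative of [q] is [t^-1 ^+ 4] times Kraus' expression for [k = 1 - t / T], because
     [A t = k ^+ 2] and [t] times the derivative of [A] is [- 2 * k * (1 - k)]. *)
  have := @operator_concave_kraus u w (u1 t) b t (1 - t / T) uconc wc wE.
  rewrite t0 t1 => /(_ isT dut).
  have ti4 : 0 < t^-1 ^+ 4 by rewrite exprn_gt0 // invr_gt0.
  rewrite -(pmulr_rle0 _ ti4).
  apply: le_trans; rewrite le_eqVlt; apply/orP; left; apply/eqP.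
  rewrite w0 -/c /A /GRing.scale /= -[(A * G) t]/(A t * G t) /A /G.
  by move: (T^-1) => i; field.
have qT (s : R) : 0 < s < T -> - c / T <= q s.
  move=> /andP[s0 sT].
  have sx (x : R) : x \in `[s, T] -> 0 < x <= T.
    by rewrite in_itv /= => /andP[sx ->]; rewrite (lt_le_trans s0).
  have dq' (x : R) : x \in `[s, T] -> derive1 q x <= 0 /\ is_derive x 1 q (derive1 q x).
    move=> /sx /dq[q1 q1le qq1]; rewrite derive1E; split; last exact/derivableP/ex_derive.
    by case: qq1 => _ ->.
  have [x xsT||x xsT qTE] := @MVT R q ((derive1 q)) s T sT.
  - exact: (dq' x (subset_itv_oo_cc xsT)).2.
  - by apply: derivable_within_continuous => x /dq'[_ ?]; exact: ex_derive.
  have qTc : q T = - c / T.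
    rewrite /q; have -> : A T = 0 by rewrite /A; field; rewrite gt_eqF.
    by rewrite !mul0r !mul1r expr1 sub0r mulNr.
  rewrite -qTc -subr_le0 qTE pmulr_lle0 ?subr_gt0 //.
  by have [] := dq' x (subset_itv_oo_cc xsT).
(* The right side is [psi 0], with zeros left unsimplified to match the definition of [psi] below,
   the continuous extension of [q] to 0. Its value is [a / 6 - 2 * c / T]. *)
suff : - c / T <= (1 - 0 / T) * ((1 - 0 / T) * r 0) + c * (0 / (T * T) - 2 / T).
  rewrite r0 /c mul0r subr0 !mul1r mul0r sub0r -subr_ge0 -(pmulr_rge0 _ T0).
  have -> : T * (a / 6 + u2 0 / 2 * - (2 / T) - - (u2 0 / 2) / T) =
      (a * T - 3 * u2 0) / 6 by field; rewrite gt_eqF.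
  by rewrite pmulr_lge0 ?invr_gt0 // subr_ge0.
pose psi s := (1 - s / T) * ((1 - s / T) * r s) + c * (s / (T * T) - 2 / T).
have psic : psi s @[s --> (0 : R)^'+] --> psi 0.
  have Fid : s @[s --> (0 : R)^'+] --> (0 : R) by exact: cvg_at_right_filter.
  have Fr : r s @[s --> (0 : R)^'+] --> r 0 by exact: cvg_at_right_filter.
  by rewrite /psi; repeat cvg_step.
apply: (cvgr_to_ge psic); near=> s.
have s0 : 0 < s by near: s; exact: nbhs_right_gt.
have sT : s < T by near: s; exact: nbhs_right_lt.
have := qT s; rewrite s0 sT => /(_ isT).
congr (_ <= _); rewrite /q /A /G rE -/b -/c /psi.
by field; rewrite !gt_eqF.
Unshelve. all: by end_near. Qed.

End ThirdDerivative.

(** * Inner products and dual cones in finite dimension *)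

Lemma continuous_sum {R : numFieldType} {T : topologicalType}
    {V : normedModType R} m (f : 'I_m -> T -> V) :
  (forall i, continuous (f i)) -> continuous (fun x => \sum_i f i x).
Proof.
by move=> fc; apply: continuous_big => [|i _]; [exact: add_continuous|exact: fc].
Qed.

Lemma convex_setE {R : numFieldType} {V : lmodType R} (A : set V) x y (l : R) :
  convex_set (A : set (convex_lmodType V)) -> A x -> A y -> 0 <= l <= 1 ->
  A (l *: x + (1 - l) *: y).
Proof.
move=> Aconvex Ax Ay /andP[l0 l1].
have := Aconvex x y (Itv01 l0 l1) (mem_set Ax) (mem_set Ay).
by move/set_mem.
Qed.

Section FiniteDimension.
Import VectorInternalTheory.
Context {R : realType} {W : normedVectType R}.
Local Notation n := (dim W).
Implicit Types (u : 'rV[R]_n) (w : W).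

Lemma r2v_sum u : r2v u = \sum_i u 0 i *: r2v (delta_mx 0 i) :> W.
Proof.
by rewrite {1}[u]row_sum_delta linear_sum; under eq_bigr do rewrite linearZ.
Qed.

Lemma r2v_continuous : continuous (r2v : 'rV[R]_n -> W).
Proof.
have -> : (r2v : 'rV[R]_n -> W) =
    fun u => \sum_i u 0 i *: r2v (delta_mx 0 i) by apply/funext => ?; exact: r2v_sum.
apply: continuous_sum => i u.
have uc : v 0 i @[v --> u] --> u 0 i by exact: coord_continuous.
refine (@cvgZr_tmp R W _ (nbhs u) _ (fun v : 'rV[R]_n => v 0 i) (u 0 i)
  (r2v (delta_mx 0 i)) uc).
Qed.

(** The constant is the minimum of [N] on the compact unit sphere. Degree 1 yields the equivalence
    of norms, degree 2 the coercivity of the inner product. *)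
Lemma homogeneous_lower_bound (N : 'rV[R]_n -> R) k : continuous N ->
  (forall a u, 0 <= a -> N (a *: u) = a ^+ k.+1 * N u) ->
  (forall u, u != 0 -> 0 < N u) ->
  exists2 m, 0 < m & forall u, m * `|u| ^+ k.+1 <= N u.
Proof.
move=> Nc Nhom Npos.
have N0 : N 0 = 0 by rewrite -(scale0r (0 : 'rV[R]_n)) Nhom // expr0n mul0r.
pose S := [set u : 'rV[R]_n | `|u| = 1].
(* The sphere is empty exactly in dimension 0, where every vector is 0 and the constant 1 will
   do. *)
have [S0|/set0P[u0 Su0]] := eqVneq S set0; last first.
  have Sclosed : closed S.
    apply: (@preimage_closed _ _ (fun u : 'rV[R]_n => `|u|) [set x | x = 1]).
      by move=> u _; exact: norm_continuous.
    exact: closed_eq.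
  have Sbounded : bounded_set S.
    exists 1; split=> // M M1 u; rewrite /S /= => ->; exact: ltW.
  have [|c cS cmin] := @EVT_min_rV _ _ N S (ex_intro S _ Su0)
    (bounded_closed_compact Sbounded Sclosed).
    exact: continuous_subspaceT.
  move: cS; rewrite inE /S /= => c1.
  exists (N c); first by rewrite Npos // -normr_gt0 c1.
  move=> u; have [->|u_neq0] := eqVneq u 0; first by rewrite N0 normr0 expr0n mulr0.
  have nu0 : 0 < `|u| by rewrite normr_gt0.
  rewrite mulrC -[X in _ <= N X](scalerKV (lt0r_neq0 nu0)) Nhom //.
  rewrite ler_pM2l ?exprn_gt0 // cmin // inE /S /=.
  by rewrite normrZ normfV normr_id mulVf // gt_eqF.
exists 1 => // u; rewrite mul1r; have [->|u_neq0] := eqVneq u 0.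
  by rewrite N0 normr0 expr0n.
suff : S (`|u|^-1 *: u) by rewrite S0.
by rewrite /S /= normrZ normfV normr_id mulVf // normr_eq0.
Qed.

Lemma v2r_continuous : continuous (v2r : W -> 'rV[R]_n).
Proof.
have [|a u a0|u u0|m m0 mP] := @homogeneous_lower_bound (fun u => `|r2v u : W|) 0.
- move=> u; have ru : r2v v @[v --> u] --> (r2v u : W) by exact: r2v_continuous.
  exact: (cvg_norm ru).
- by rewrite linearZ /= normrZ ger0_norm.
- rewrite normr_gt0; apply: contra_neq u0 => r2v0.
  by rewrite -[u]r2vK r2v0 linear0.
move=> w; apply/cvgrPdist_le => e e0; near=> w'.
rewrite -(ler_pM2l m0) -linearB /= -[`|_|]expr1 (le_trans (mP _)) // v2rK.
near: w'; apply: cvgr_dist_le => //; exact: mulr_gt0.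
Unshelve. all: by end_near. Qed.

Lemma v2r_coord_continuous i : continuous (fun w => v2r w 0 i).
Proof.
move=> w; have vc : v2r v @[v --> w] --> v2r w by exact: v2r_continuous.
apply: (cvg_comp v2r (fun u : 'rV[R]_n => u 0 i) vc); exact: coord_continuous.
Qed.

Section InnerProduct.
Variable ip : {dot W for idfun}.

Lemma ipC x y : ip x y = ip y x.
Proof. by rewrite hermitian_subproof expr0 mul1r. Qed.

Lemma ipDr x y z : ip x (y + z) = ip x y + ip x z.
Proof. exact: linearDr. Qed.

Lemma ipZr x a y : ip x (a *: y) = a * ip x y.
Proof. by rewrite linearZr_LR. Qed.

Lemma ip_r2v z u : ip z (r2v u) = \sum_i u 0 i * ip z (r2v (delta_mx 0 i)).
Proof.
by rewrite r2v_sum linear_sumr; apply: eq_bigr => i _; exact: ipZr.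
Qed.

(** The inner product is purely algebraic and not tied to the norm of [W]; continuity comes from
    expanding in coordinates. *)
Lemma ip_continuous z : continuous (ip z : W -> R).
Proof.
have -> : (ip z : W -> R) =
    fun w => \sum_i v2r w 0 i * ip z (r2v (delta_mx 0 i)).
  by apply/funext => w; rewrite -[in LHS](v2rK w) ip_r2v.
apply: (@continuous_sum _ _ R) => i w; apply: cvgM; last exact: cvg_cst.
exact: v2r_coord_continuous.
Qed.

Lemma ip_diag_continuous : continuous (fun w => ip w w).
Proof.
have -> : (fun w => ip w w) =
    fun w => \sum_i v2r w 0 i * ip w (r2v (delta_mx 0 i)).
  by apply/funext => w; rewrite -[in X in ip w X = _](v2rK w) ip_r2v.
apply: (@continuous_sum _ _ R) => i w; apply: cvgM.
  exact: v2r_coord_continuous.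
under eq_fun do rewrite ipC; rewrite ipC.
exact: ip_continuous.
Qed.

Lemma ip_ge0 x : 0 <= ip x x.
Proof.
by have [->|/neq0_dnorm_gt0/ltW//] := eqVneq x 0; rewrite linear0r.
Qed.

Lemma ip_eq0 x : ip x x <= 0 -> x = 0.
Proof. by apply: contraTeq => /(neq0_dnorm_gt0 (s := ip)); rewrite ltNge. Qed.

Lemma ip_sqD x y a : ip (x + a *: y) (x + a *: y) =
  ip x x + 2 * a * ip x y + a ^+ 2 * ip y y.
Proof.
rewrite ipDr ipZr ipC ipDr ipZr (ipC (x + _) y) ipDr ipZr (ipC y x); ring.
Qed.

(** Distance is measured by [ip]. In coordinates, the points of [K] at least as close to [w] as [y0]
    form a compact set, on which the distance attains its minimum. *)
Lemma closest_point (K : set W) w : closed K -> K !=set0 ->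
  exists2 p, K p & forall y, K y -> ip (p - w) (p - w) <= ip (y - w) (y - w).
Proof.
move=> Kclosed [y0 Ky0].
pose Q y := ip (y - w) (y - w).
have r2vc u : r2v v @[v --> u] --> (r2v u : W) by exact: r2v_continuous.
have [|a u a0|u u0|m m0 mP] := @homogeneous_lower_bound (fun u => ip (r2v u) (r2v u)) 1.
- by move=> u; apply: (cvg_comp r2v (fun x => ip x x) (r2vc u)); exact: ip_diag_continuous.
- by rewrite linearZ /= ipZr ipC ipZr; ring.
- apply: neq0_dnorm_gt0; apply: contra_neq u0 => r2v0.
  by rewrite -[u]r2vK r2v0 linear0.
pose S := [set u | K (r2v u) /\ Q (r2v u) <= Q y0].
have Qrc : continuous (fun u => Q (r2v u)).
  move=> u; have rw : r2v v - w @[v --> u] --> r2v u - w.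
    exact: (cvgB (r2vc u) (cvg_cst w)).
  by apply: (cvg_comp (fun v => r2v v - w) (fun x => ip x x) rw); exact: ip_diag_continuous.
have Sclosed : closed S.
  have S1 : closed ((r2v : 'rV[R]_n -> W) @^-1` K).
    by apply: preimage_closed => // u _; exact: r2v_continuous.
  have S2 : closed ((fun u => Q (r2v u)) @^-1` [set x | x <= Q y0]).
    by apply: preimage_closed => [u _|]; [exact: Qrc|exact: closed_le].
  exact: closedI S1 S2.
have Sbounded : bounded_set S.
  pose B := 2 * (Q y0 + ip w w) / m.
  (* From [|u| ^+ 2 <= B] follows [|u| <= 1 + B], which avoids a square root. *)
  exists (1 + B); split; first exact: num_real.
  move=> M BM u [_ Qu].
  have uB : `|u| ^+ 2 <= B.
    rewrite ler_pdivlMr // mulrC (le_trans (mP u)) //.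
    (* With [y = r2v u], nonnegativity of [|y - 2 w|^2] amounts to [|y|^2 <= 2 |y - w|^2 + 2 |w|^2]
       in the norm of [ip]. *)
    have := ip_ge0 (r2v u + (- 2) *: w); rewrite ip_sqD.
    by move: Qu; rewrite /Q -{1 2}(scaleN1r w) ip_sqD; lra.
  by apply: le_trans (ltW BM); nra.
have Sy0 : S (v2r y0) by rewrite /S /= v2rK.
have [|c cS cmin] := @EVT_min_rV _ _ (fun u => Q (r2v u)) S (ex_intro S _ Sy0)
    (bounded_closed_compact Sbounded Sclosed).
  exact: continuous_subspaceT.
move: cS; rewrite inE => -[Kc Qc].
exists (r2v c) => // y Ky; have [Qy|/ltW Qy] := leP (Q y) (Q y0); last first.
  exact: le_trans Qc Qy.
by have := cmin (v2r y); rewrite inE /S /= v2rK; exact.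
Qed.

(** Let [p] be the point of [K] closest to [w] and [z = p - w]. Then [z] lies in the dual cone and
    [<z, p> <= 0], so [0 <= <z, w> = <z, p> - <z, z>] forces [z = 0]. *)
Lemma dual_dual_cone (K : set W) w : proper_convex_cone K ->
  (forall z, dual_cone ip K z -> 0 <= ip z w) -> K w.
Proof.
case=> Kclosed [Kconvex Kscale] _ [k0 /interior_subset Kk0] wdual.
have KD x y a : K x -> K y -> 0 <= a -> K (x + a *: y).
  move=> Kx Ky a0.
  have half01 : 0 <= (2^-1 : R) <= 1 by apply/andP; split; lra.
  have := Kscale 2 _ (ler0n _ _)
    (convex_setE Kconvex Kx (Kscale _ _ a0 Ky) half01).
  have -> : 1 - 2^-1 = 2^-1 :> R by field.
  by rewrite -scalerDr scalerKV ?pnatr_eq0.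
have [p Kp pmin] := @closest_point K w Kclosed (ex_intro K _ Kk0).
pose z := p - w.
have descent y : (forall a, 0 < a <= 1 -> K (p + a *: y)) -> 0 <= ip z y.
  move=> Ky; rewrite leNgt; apply/negP => zy.
  have yy := ip_ge0 y; have d0 : 0 < ip y y - ip z y by lra.
  (* The optimal step would be [- <z, y> / <y, y>]; the enlarged denominator keeps [a] at most 1 and
     still decreases the distance. *)
  pose a := - ip z y / (ip y y - ip z y).
  have a01 : 0 < a <= 1.
    by rewrite divr_gt0 ?oppr_gt0 //= ler_pdivrMr // mul1r; lra.
  have [a0 _] := andP a01; have := pmin _ (Ky a a01).
  rewrite addrAC -/z ip_sqD.
  have aE : a * ip y y - a * ip z y = - ip z y by rewrite -mulrBr divfK ?gt_eqF.
  by nra.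
have zdual : dual_cone ip K z.
  by move=> y Ky; apply: descent => a /andP[/ltW a0 _]; exact: KD.
(* Moving from [p] towards the apex stays in [K], as [p - a p = (1 - a) p] with [a <= 1]. *)
have : 0 <= ip z (- p).
  apply: descent => a /andP[_ a1].
  by rewrite scalerN -{1}(scale1r p) -scalerBl; apply: Kscale; rewrite ?subr_ge0.
have := wdual z zdual.
rewrite -{1}(subKr p w : p - z = w) => zw zp.
have : z = 0.
  apply: ip_eq0; move: zw zp; rewrite ipDr !linearNr; lra.
by rewrite /z => /eqP; rewrite subr_eq0 => /eqP <-.
Qed.

End InnerProduct.
End FiniteDimension.

(** * Compatibility *)

(** Choose [y] in [D] so close to [x + h] that [x + c *: (x + h - y)] remains in the open set [D];
    with [c = t / (1 - t)] the point [x + t *: h] is a convex combination of the two. *)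
Lemma open_convex_segment {R : realType} {V : normedModType R} (D : set V) x h
    (t : R) :
  open D -> convex_set (D : set (convex_lmodType V)) -> D x ->
  closure D (x + h) -> 0 <= t < 1 -> D (x + t *: h).
Proof.
move=> Dopen Dconvex Dx Dxh /andP[t0 t1].
have t1' : 0 < 1 - t by rewrite subr_gt0.
pose c := t / (1 - t).
have xc : x + c *: (x + h - y) @[y --> x + h] --> x + c *: (x + h - (x + h)).
  apply: cvgD; first exact: cvg_cst.
  apply: cvgZl_tmp; apply: cvgB; [exact: cvg_cst|exact: cvg_id].
have [y [Dy Dxy]] : D `&` (fun y => D (x + c *: (x + h - y))) !=set0.
  apply: Dxh; apply: xc; rewrite subrr scaler0 addr0.
  exact: open_nbhs_nbhs.
have -> : x + t *: h = t *: y + (1 - t) *: (x + c *: (x + h - y)).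
  rewrite scalerDr scalerA mulrC divfK ?gt_eqF // scalerBr scalerDr.
  by rewrite scalerBl scale1r [RHS]addrC -!addrA addNr addr0 addKr.
by apply: convex_setE => //; rewrite t0 ltW.
Qed.

Lemma open_convex_line {R : realType} {V : normedModType R} (D : set V) x h
    (t : R) :
  open D -> convex_set (D : set (convex_lmodType V)) -> D x ->
  closure D (x + h) -> closure D (x - h) -> -1 < t < 1 -> D (x + t *: h).
Proof.
move=> Dopen Dconvex Dx Dxh Dxnh /andP[t1 t2].
have [t0|/ltW t0] := leP 0 t; first by apply: open_convex_segment; rewrite ?t0.
rewrite -[t *: h]opprK -scaleNr -scalerN.
by apply: open_convex_segment; rewrite // oppr_ge0 t0 ltrNl.
Qed.

Lemma is_derive_ip_line {R : realType} {V : normedModType R}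
    {W : normedVectType R} (ip : {dot W for idfun}) z (phi : V -> W) x h (t : R) :
  differentiable phi (x + t *: h) ->
  is_derive t 1 (fun s => ip z (phi (x + s *: h))) (ip z ('D_h phi (x + t *: h))).
Proof.
move=> /(diff_derivable (v := h)) dphi.
have ipc : ip z (s^-1 *: ((phi \o shift (x + t *: h)) (s *: h) - phi (x + t *: h)))
    @[s --> (0 : R)^'] --> ip z ('D_h phi (x + t *: h)).
  by apply: (cvg_comp _ (ip z) dphi); exact: ip_continuous.
have {}ipc : s^-1 *: (((fun s => ip z (phi (x + s *: h))) \o shift t) (s *: 1)
     - ip z (phi (x + t *: h))) @[s --> (0 : R)^'] --> ip z ('D_h phi (x + t *: h)).
  apply: cvg_trans ipc; apply: near_eq_cvg; near=> s.
  rewrite ipZr linearBr /= [s *: 1]mulr1 scalerDl addrCA [x + (_ + _)]addrCA.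
  by [].
by split; [apply/cvg_ex; eexists; exact: ipc|exact: cvg_lim].
Unshelve. all: by end_near. Qed.

Section Compatibility.
Context {R : realType} {V V' : normedVectType R} (ip : {dot V' for idfun}).
Implicit Types (K : set V') (D : set V) (f : V -> V').

(** The segment has midpoint [m] and half-difference [k]. Its ends would have parameters -1 and 1,
    outside the open interval, so it is first lengthened by a factor [1 + d], which openness of [D]
    permits. *)
Lemma operator_concave_line_concave D f z :
  open D -> convex_set (D : set (convex_lmodType V)) ->
  (forall x h, D x -> closure D (x + h) -> closure D (x - h) ->
    operator_concave (-1) 1 (fun t => ip z (f (x + t *: h)))) ->
  forall x y (l : R), D x -> D y -> 0 <= l <= 1 ->
  l * ip z (f x) + (1 - l) * ip z (f y) <= ip z (f (l *: x + (1 - l) *: y)).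
Proof.
move=> Dopen Dconvex fconc x y l Dx Dy l01.
pose m := 2^-1 *: x + (1 - 2^-1) *: y.
pose k := 2^-1 *: (y - x).
have shrink p v : D p -> \forall d \near (0 : R)^'+, D (p + d *: v).
  move=> Dp; have pc : p + d *: v @[d --> (0 : R)] --> p + 0 *: v.
    by apply: cvgD; [exact: cvg_cst|apply: cvgZr_tmp; exact: cvg_id].
  apply: (cvg_at_right_filter pc); rewrite scale0r addr0.
  exact: open_nbhs_nbhs.
have Dm : D m by apply: convex_setE => //; apply/andP; split; lra.
near (0 : R)^'+ => d.
have d0 : 0 < d by near: d; exact: nbhs_right_gt.
have Dyd : D (y + d *: k) by near: d; exact: shrink.
have Dxd : D (x + d *: - k) by near: d; exact: shrink.
have half : 1 - 2^-1 = 2^-1 :> R by field.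
have half1 : 2^-1 + 2^-1 = 1 :> R by field.
have mx : m - k = x.
  by rewrite /m /k half scalerBr opprB addrACA subrr addr0 -scalerDl half1 scale1r.
have my : m + k = y.
  rewrite /m /k half scalerBr [_ *: y - _]addrC addrACA subrr add0r.
  by rewrite -scalerDl half1 scale1r.
have yE : y + d *: k = m + (1 + d) *: k by rewrite scalerDl scale1r addrA my.
have xE : x + d *: - k = m - (1 + d) *: k.
  by rewrite scalerDl scale1r opprD addrA mx scalerN.
clearbody k m; have d1 : 0 < 1 + d by rewrite addr_gt0.
have gconc := fconc m ((1 + d) *: k) Dm.
rewrite -yE -xE in gconc.
have {}gconc := gconc (subset_closure Dyd) (subset_closure Dxd).
have s1 : -1 < - (1 + d)^-1 < 1.
  by rewrite ltrN2 invf_lt1 // ltrDl d0 (@lt_trans _ _ 0) // oppr_lt0 invr_gt0.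
have s2 : -1 < (1 + d)^-1 < 1.
  by have /andP[] := s1 => ? ?; apply/andP; split; lra.
have s0 : -1 < (0 : R) < 1 by rewrite ltr01 oppr_lt0 ltr01.
(* With tilt 0 and test vector (1, 1) this is the scalar Jensen inequality, with the value at
   parameter 0 added to both sides. *)
have := @operator_concave_jensen2 _ _ _ _ l _ _ 0 0 1 gconc l01 s1 s2 s0 (mul0r _).
have z2 : 0 ^+ 2 = 0 :> R by rewrite expr0n.
rewrite !(z2, mulr0, mul0r, addr0, add0r, subr0, expr1n, mul1r, divr1, scale0r).
rewrite !scaleNr !scalerA mulVf ?gt_eqF // scale1r mx my.
set c := ip z (f m) => ineq.
have -> : l *: x + (1 - l) *: y =
    m + ((l * - (1 + d)^-1 + (1 - l) * (1 + d)^-1) * (1 + d)) *: k.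
  have -> : (l * - (1 + d)^-1 + (1 - l) * (1 + d)^-1) * (1 + d) = 1 - l - l.
    by field; rewrite gt_eqF.
  rewrite -{1}mx -{1}my scalerBr scalerDr addrACA -!scalerDl -scaleNr -scalerDl.
  by rewrite subrKC scale1r [- l + _]addrC.
move: ineq; lra.
Unshelve. all: by end_near. Qed.

(** Traversing the line in direction [- h] flips the sign of the odd derivatives only, which turns
    the lower bound on the third derivative into the required upper bound. *)
Lemma dirderiv_le D f z x h : Cclass 3 D f ->
  open D -> convex_set (D : set (convex_lmodType V)) ->
  (forall x h, D x -> closure D (x + h) -> closure D (x - h) ->
    operator_concave (-1) 1 (fun t => ip z (f (x + t *: h)))) ->
  D x -> closure D (x + h) -> closure D (x - h) ->
  ip z (dirderiv 3 f h x) <= - 3 * ip z (dirderiv 2 f h x).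
Proof.
move=> [fd f2] Dopen Dconvex fconc Dx Dxh Dxnh.
have [f2d f3] := f2 h; have [f3d _] := f3 h.
have Dline (t : R) : -1 < t < 1 -> D (x + t *: - h).
  by apply: open_convex_line => //; rewrite opprK.
have du (phi : V -> V') (t : R) : (forall y, D y -> differentiable phi y) ->
    -1 < t < 1 -> is_derive t 1 (fun s => ip z (phi (x + s *: - h)))
      (- ip z ('D_h phi (x + t *: - h))).
  move=> phid /Dline/phid dphi; apply: is_derive_eq (is_derive_ip_line _ _ dphi) _.
  by rewrite !deriveE // linearN linearNr.
have d0 : -1 < (0 : R) < 1 by rewrite ltr01 oppr_lt0 ltr01.
have := @operator_concave_third_derivative R
  (fun t => ip z (f (x + t *: - h)))
  (fun t => - ip z ('D_h f (x + t *: - h)))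
  (fun t => ip z ('D_h ('D_h f) (x + t *: - h)))
  (- ip z ('D_h ('D_h ('D_h f)) (x + 0 *: - h))).
rewrite scale0r addr0 => third.
rewrite mulNr -lerN2 opprK; apply: third.
- by apply: fconc; rewrite ?opprK.
- by move=> t; exact: du.
- move=> t t1; rewrite -[ip z _]opprK; apply: is_deriveN; exact: du.
- by have := du _ _ f3d d0; rewrite scale0r addr0.
Qed.

End Compatibility.

Unset Implicit Arguments.
Theorem theorem3p1 (R : realType) (V V' : normedVectType R)
  (ip : {dot V' for idfun}) (K : set V') (D : set V) (f : V -> V')
  (K_proper : proper_convex_cone K)
  (D_open : open D) (D_convex : convex_set (D : set (convex_lmodType V)))
  (f_C3 : Cclass 3 D f)
  (f_opconc : forall z x h, dual_cone ip K z -> D x ->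
     closure D (x + h) -> closure D (x - h) ->
     operator_concave (-1) 1 (fun t => ip z (f (x + t *: h)))) :
  compatible K 1 D f.
Proof.
split=> [x y l Dx Dy l01|x h Dx Dxh Dxnh].
  rewrite /cone_le; apply: (dual_dual_cone (ip := ip) K_proper) => z zK.
  have -> : ip z (f (l *: x + (1 - l) *: y) - (l *: f x + (1 - l) *: f y)) =
      ip z (f (l *: x + (1 - l) *: y)) - (l * ip z (f x) + (1 - l) * ip z (f y)).
    by rewrite linearBr -!ipZr -ipDr.
  rewrite subr_ge0.
  apply: (operator_concave_line_concave D_open D_convex _ Dx Dy l01) => p h.
  exact: (f_opconc z p h zK).
rewrite /cone_le; apply: (dual_dual_cone (ip := ip) K_proper) => z zK.
have -> : ip z (- (3 * 1) *: dirderiv 2 f h x - dirderiv 3 f h x) =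
    - 3 * ip z (dirderiv 2 f h x) - ip z (dirderiv 3 f h x).
  by rewrite linearBr mulr1 -ipZr.
rewrite subr_ge0.
apply: (dirderiv_le f_C3 D_open D_convex _ Dx Dxh Dxnh) => p k.
exact: (f_opconc z p k zK).
Qed.
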